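(* Let $\alpha\in\{+,-\}$. A bidirected graph with vertex $r$ is an $\alpha$-radial with strong root $r$ if and only if it is a gluing sum $(G;s)\oplus(H;V(H))$, where $G$ is a member of $\mathcal{L}^{\alpha}(s)$ and $H$ is a strong $\alpha$-radial with root $r$ (with $G$ and $H$ disjoint).
   Context: A bidirected graph is a finite graph (loops and parallel edges allowed) in which each of the two ends of each edge carries a sign $+$ or $-$; we speak of the sign of $v$ over $e$ (a loop has two ends, each with its own sign). $-\alpha$ denotes the sign opposite to $\alpha$. A ditrail from $x$ to $y$ is a sequence $(v_0,e_1,v_1,\dots,e_k,v_k)$, $k\ge 0$, $v_0=x$, $v_k=y$, where the $e_i$ are pairwise distinct edges (vertices may repeat), $e_i$ joins $v_{i-1}$ and $v_i$, and for $1\le i<k$ the sign of the end of $e_i$ by which it arrives at $v_i$ is opposite to the sign of the end of $e_{i+1}$ by which it leaves $v_i$. If $k\ge1$ it is an $(\alpha,\beta)$-ditrail when the sign of $v_0$ over $e_1$ is $\alpha$ and the sign of $v_k$ over $e_k$ is $\beta$; the trivial ditrail ($k=0$) is regarded as both a $(+,-)$- and a $(-,+)$-ditrail. An $\alpha$-ditrail is an $(\alpha,+)$- or $(\alpha,-)$-ditrail. A closed ditrail over $r$ is a ditrail from $r$ to $r$. A bidirected graph $G$ with $r\in V(G)$ is an $\alpha$-radial (resp. $\alpha$-semiradial) with root $r$ if for every $v\in V(G)$ there is an $(\alpha,-\alpha)$-ditrail (resp. an $\alpha$-ditrail) from $v$ to $r$. In an $\alpha$-radial with root $r$ a vertex $x$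 is strong if there is a $(-\alpha,-\alpha)$-ditrail from $x$ to $r$; ''strong root'' means that $r$ itself is strong. An $\alpha$-radial $G$ with root $r$ is strong if every $v\in V(G)$ (including $r$) is strong. It is almost strong if for every $v\in V(G)\setminus\{r\}$ there is a $(-\alpha,-\alpha)$-ditrail from $v$ to $r$, but there is no closed $(-\alpha,-\alpha)$-ditrail over $r$. An $\alpha$-semiradial $G$ with root $r$ is linear if it has no loop over $r$ and there is no $-\alpha$-ditrail from $x$ to $r$ for any $x\in V(G)$, except for the trivial ditrail from $r$ to $r$. Gluing sum. Let $G,H$ be disjoint bidirected graphs, $s\in V(G)$, $T\subseteq V(H)$. A gluing sum $(G;s)\oplus(H;T)$ is any bidirected graph $\hat G$ with $V(\hat G)=(V(G)\setminus\{s\})\cup V(H)$ whose edges are: all edges of $G$ not incident with $s$, all edges of $H$, and, for each edge $e$ of $G$ incident with $s$, exactly one edge $f(e)$ such that: if $e$ joins $s$ and $v\neq s$, then $f(e)$ joins some $t\in T$ and $v$, with the signs of $t$ and $v$ over $f(e)$ equal to the signs of $s$ and $v$ over $e$; if $e$ is a loop over $s$ with signs $\alpha_1,\alpha_2$, then $f(e)$ joins two (possibly identical) vertices of $T$ with signs $\alpha_1,\alpha_2$. (Gluing sums are not unique.) The sets $\mathcal{R}^{\alpha}(r)$ and $\mathcal{L}^{\alpha}(r)$ of bidirected graphs with vertex $r$ are defined simultaneously (for all vertex symbols $r$) as the smallest sets satisfying: (i) every almost strong $\alpha$-radial with root $r$ is in $\mathcal{R}^{\alpha}(r)$; (ii)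 every linear $\alpha$-semiradial with root $r$ is in $\mathcal{L}^{\alpha}(r)$; (iii) if $G\in\mathcal{R}^{\alpha}(r)$, then any bidirected graph obtained from $G$ by adding some edges of the form $rv$, $v\in V(G)$, in which $r$ has sign $\alpha$, is in $\mathcal{R}^{\alpha}(r)$; (iv) if $G\in\mathcal{L}^{\alpha}(s)$ and $H$ is an almost strong $\alpha$-radial with root $r$ with $V(G)\cap V(H)=\emptyset$, then any gluing sum $(G;s)\oplus(H;V(H)\setminus\{r\})$ is in $\mathcal{R}^{\alpha}(r)$; (v) if $G\in\mathcal{R}^{\alpha}(s)$ and $H$ is a linear $\alpha$-semiradial with root $r$ with $V(G)\cap V(H)=\emptyset$, then any gluing sum $(G;s)\oplus(H;V(H)\setminus\{r\})$ is in $\mathcal{L}^{\alpha}(r)$. *)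

(* Defs.v *)
From HB Require Import structures.
From mathcomp Require Import all_boot.

Set Implicit Arguments.
Unset Strict Implicit.
Unset Printing Implicit Defensive.

(* Signs are booleans (true for +, false for -), so that -a is ~~ a.  The two
   ends of an edge are named by booleans as well: [endv e b] is the vertex at
   end [b] of [e] and [sgn e b] the sign of that end.  The naming of the ends
   carries no information: it is forgotten by [is_iso] below. *)
Record bigraph := Bigraph {
  vert : finType;
  edge : finType;
  endv : edge -> bool -> vert;
  sgn : edge -> bool -> bool
}.

(* An edge with a direction of traversal: [(e, b)] leaves by end [b] of [e] and
   arrives by the other end.  For a loop both directions are possible. *)
Definition dart (G : bigraph) : Type := (edge G * bool)%type.

Section Ditrails.
Variable G : bigraph.
Implicit Types (x y r v : vert G) (d : dart G) (p : seq (dart G)) (a b : bool).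

Definition dsrc d : vert G := endv d.1 d.2.
Definition dtgt d : vert G := endv d.1 (~~ d.2).
Definition dsgn_out d : bool := sgn d.1 d.2.
Definition dsgn_in d : bool := sgn d.1 (~~ d.2).

Fixpoint joins x p y : bool :=
  if p is d :: p' then (dsrc d == x) && joins (dtgt d) p' y else x == y.

Definition ditrail x y p : bool :=
  [&& joins x p y,
      uniq [seq d.1 | d <- p]
    & sorted (fun d d' => dsgn_in d != dsgn_out d') p].

(* The trivial ditrail is both a (+,-)- and a (-,+)-ditrail. *)
Definition has_signs a b p : bool :=
  if p is d :: p' then (dsgn_out d == a) && (dsgn_in (last d p') == b)
  else a != b.

Definition ab_ditrail a b x y p : bool := ditrail x y p && has_signs a b p.

Definition a_ditrail a x y p : bool :=
  ab_ditrail a true x y p || ab_ditrail a false x y p.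

Definition radial a r : Prop :=
  forall v, exists p, ab_ditrail a (~~ a) v r p.

Definition semiradial a r : Prop :=
  forall v, exists p, a_ditrail a v r p.

Definition strong_vertex a r x : Prop :=
  exists p, ab_ditrail (~~ a) (~~ a) x r p.

Definition strong_radial a r : Prop :=
  radial a r /\ forall v, strong_vertex a r v.

Definition almost_strong_radial a r : Prop :=
  [/\ radial a r,
      forall v, v != r -> exists p, ab_ditrail (~~ a) (~~ a) v r p
    & ~ exists p, ab_ditrail (~~ a) (~~ a) r r p].

Definition loop_over r (e : edge G) : Prop := forall b, endv e b = r.

Definition linear_semiradial a r : Prop :=
  [/\ semiradial a r,
      ~ (exists e, loop_over r e)
    & forall x p, a_ditrail (~~ a) x r p -> p = [::]].

End Ditrails.

(* [f] is the vertex part of an isomorphism; [flip e] tells whether the names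
   of the two ends of [e] are exchanged. *)
Definition is_iso (G H : bigraph) (f : vert G -> vert H) : Prop :=
  bijective f /\
  exists (g : edge G -> edge H) (flip : edge G -> bool),
    bijective g /\
    forall e b, endv (g e) (flip e (+) b) = f (endv e b) /\
                sgn (g e) (flip e (+) b) = sgn e b.

(* The vertex set is the disjoint union of V(G) \ {s} and V(H), so that G and H
   are automatically disjoint.  Each end [b] of an edge [e] of G which lies at s
   is moved to [att e b]; the other values of [att] are irrelevant. *)
Definition glue (G : bigraph) (s : vert G) (H : bigraph)
    (att : edge G -> bool -> vert H) : bigraph :=
  @Bigraph ({v : vert G | v != s} + vert H)%type (edge G + edge H)%type
    (fun e b => match e with
                | inl e1 => match insub (endv e1 b) with
                            | Some u => inl u
                            | None => inr (att e1 b)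
                            end
                | inr e2 => inr (endv e2 b)
                end)
    (fun e b => match e with
                | inl e1 => sgn e1 b
                | inr e2 => sgn e2 b
                end).

(* [K] is, up to isomorphism, a gluing sum (G; s) (+) (H; T), and [i] is the
   resulting inclusion of V(H) into V(K). *)
Definition gluing_sum (G : bigraph) (s : vert G) (H : bigraph)
    (T : {set vert H}) (K : bigraph) (i : vert H -> vert K) : Prop :=
  exists att : edge G -> bool -> vert H,
    (forall e b, endv e b = s -> att e b \in T) /\
    exists f : vert (glue s att) -> vert K,
      is_iso f /\ forall w, i w = f (inr w).

(* The graph G with, for each [j : J], a new edge joining r, with sign [a], to
   [v j], with sign [c j]; [v j] may be r. *)
Definition add_edges (G : bigraph) (r : vert G) (a : bool) (J : finType)
    (v : J -> vert G) (c : J -> bool) : bigraph :=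
  @Bigraph (vert G) (edge G + J)%type
    (fun e b => match e with
                | inl e1 => endv e1 b
                | inr j => if b then v j else r
                end)
    (fun e b => match e with
                | inl e1 => sgn e1 b
                | inr j => if b then c j else a
                end).

(* [calR a r] and [calL a r], for [r : vert G], express that G belongs to
   R^a(r), respectively to L^a(r). *)
Inductive calR (a : bool) : forall G : bigraph, vert G -> Prop :=
| calR_base (G : bigraph) (r : vert G) :
    almost_strong_radial a r -> calR a r
| calR_add (G : bigraph) (r : vert G) (J : finType) (v : J -> vert G)
    (c : J -> bool) (K : bigraph) (f : vert (add_edges r a v c) -> vert K) :
    calR a r -> is_iso f -> calR a (f r)
| calR_glue (G : bigraph) (s : vert G) (H : bigraph) (r : vert H)
    (K : bigraph) (i : vert H -> vert K) :
    calL a s -> almost_strong_radial a r ->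
    gluing_sum s [set~ r] i -> calR a (i r)
with calL (a : bool) : forall G : bigraph, vert G -> Prop :=
| calL_base (G : bigraph) (r : vert G) :
    linear_semiradial a r -> calL a r
| calL_glue (G : bigraph) (s : vert G) (H : bigraph) (r : vert H)
    (K : bigraph) (i : vert H -> vert K) :
    calR a s -> linear_semiradial a r ->
    gluing_sum s [set~ r] i -> calL a (i r).

(* Main.v *)
Require Import Defs.
From mathcomp Require Import all_boot.
From mathcomp Require Import boolp.

Set Implicit Arguments.
Unset Strict Implicit.
Unset Printing Implicit Defensive.

(* Every vertex of a member of L^a(s) has an a-ditrail to s, by induction on the
   construction; strongness of H turns this into the right signs at r, which
   gives the "if" part.
   For "only if", take X maximal among the vertex sets containing r and a closed
   (-a,-a)-ditrail over r such that K[X] is a strong radial.  Contracting X to a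
   vertex s leaves a semiradial without loops over s in which no neighbour of s
   has a nontrivial -a-ditrail to s: otherwise such a ditrail, closed up by the
   edge from s, could be added to X.  These properties characterise L^a(s).
   This is proved by induction on the number of vertices together with the
   analogous characterisation of R^a(r): a-radials without closed
   (-a,-a)-ditrail over r in which every neighbour of r by an edge with sign -a
   at r has a (-a,-a)-ditrail to r.  From a graph of the first kind one
   contracts a maximal linear part made of vertices without -a-ditrail to r, and
   from one of the second kind (after deleting the edges with sign a at r) a
   maximal almost strong part; the quotient is then of the other kind. *)

(** * Trails as sequences of darts: joining, reversing and cutting *)

Section Trails.
Variable G : bigraph.
Implicit Types (x y z r v w : vert G) (d : dart G) (p q : seq (dart G)).
Implicit Types (a b c g : bool) (X Y : {set vert G}).

Definition edges p := [seq d.1 | d <- p].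
Definition flipd d : dart G := (d.1, ~~ d.2).
(** Incidence and alternation of signs are merged into one relation and the end vertices stay
    implicit, so that cutting a ditrail is just cutting a sequence. *)
Definition link : rel (dart G) :=
  fun d d' => (dtgt d == dsrc d') && (dsgn_in d != dsgn_out d').
Definition trail p := sorted link p && uniq (edges p).

(** A nontrivial trail that stops at its first arrival in [X]. Its start may lie in [X], so closed
    ditrails over the root are covered too. *)
Definition hit X d p :=
  [&& trail (d :: p), all (fun d' => dtgt d' \notin X) (belast d p)
    & dtgt (last d p) \in X].

Definition inside X (e : edge G) := (endv e true \in X) && (endv e false \in X).

Lemma inside_dart X d : inside X d.1 = (dsrc d \in X) && (dtgt d \in X).
Proof. by rewrite /inside /dsrc /dtgt; case: d => e []//=; rewrite andbC. Qed.

Lemma dsrc_flipd d : dsrc (flipd d) = dtgt d. Proof. by []. Qed.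
Lemma dtgt_flipd d : dtgt (flipd d) = dsrc d.
Proof. by rewrite /dtgt /dsrc /= negbK. Qed.
Lemma dsgn_out_flipd d : dsgn_out (flipd d) = dsgn_in d. Proof. by []. Qed.
Lemma dsgn_in_flipd d : dsgn_in (flipd d) = dsgn_out d.
Proof. by rewrite /dsgn_in /dsgn_out /= negbK. Qed.

Lemma joinsE x d p y :
  joins x (d :: p) y =
  [&& dsrc d == x, path (fun d d' => dtgt d == dsrc d') d p
    & dtgt (last d p) == y].
Proof.
rewrite /=; congr (_ && _); elim: p d => //= d' p IH d.
by rewrite IH eq_sym andbA.
Qed.

Lemma ab_ditrail_cons b c x y d p :
  ab_ditrail b c x y (d :: p) =
  [&& trail (d :: p), dsrc d == x, dtgt (last d p) == y, dsgn_out d == b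
    & dsgn_in (last d p) == c].
Proof.
rewrite /ab_ditrail /ditrail joinsE /trail [sorted link _]/=.
rewrite (@path_relI _ (fun d d' => dtgt d == dsrc d')
                      (fun d d' => dsgn_in d != dsgn_out d')).
rewrite [sorted _ _]/= [has_signs _ _ _]/=.
by rewrite -!andbA; do !bool_congr.
Qed.

Lemma ab_ditrail_nil b c x y : ab_ditrail b c x y [::] = (x == y) && (b != c).
Proof. by rewrite /ab_ditrail /ditrail /= andbT. Qed.

Lemma trail_ab d p :
  trail (d :: p) ->
  ab_ditrail (dsgn_out d) (dsgn_in (last d p)) (dsrc d) (dtgt (last d p)) (d :: p).
Proof. by rewrite ab_ditrail_cons !eqxx !andbT. Qed.

Lemma trail_cat p q : trail (p ++ q) -> trail p /\ trail q.
Proof.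
case/andP=> /cat_sorted2[sp sq]; rewrite /edges map_cat cat_uniq => /and3P[up _ uq].
by rewrite /trail sp sq.
Qed.

(** The convention on trivial ditrails makes this uniform: a trivial [p] forces [b = ~~ c], a
    trivial [q] forces [e = c]. *)
Lemma ab_cat b c e x y z p q :
  ab_ditrail b c x y p -> ab_ditrail (~~ c) e y z q ->
  ~~ has (mem (edges p)) (edges q) -> ab_ditrail b e x z (p ++ q).
Proof.
case: p => [|d p].
  by rewrite ab_ditrail_nil => /andP[/eqP-> bc]; case: b c bc => [] [].
rewrite cat_cons !ab_ditrail_cons => /and5P[/andP[sp up] -> /eqP ty -> /eqP tc].
case: q => [|d' q].
  rewrite ab_ditrail_nil => /andP[/eqP<- ce] _; rewrite cats0 /trail sp up ty eqxx tc.
  by case: c e ce {tc} => [] [].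
rewrite ab_ditrail_cons => /and5P[/andP[sq uq] /eqP sy tz sc se] dis.
rewrite last_cat /= tz se !andbT /trail; apply/andP; split.
  move: sp sq; rewrite /= cat_path /= => -> ->.
  by rewrite /link ty sy eqxx tc (eqP sc); case: (c).
by rewrite /edges -cat_cons map_cat cat_uniq up uq andbT.
Qed.

Lemma trail_rev p : trail p -> trail (rev (map flipd p)).
Proof.
case/andP=> sp up; rewrite /trail rev_sorted sorted_map; apply/andP; split.
  apply: sub_sorted sp => d d' /andP[/eqP t s].
  by rewrite /link /= dtgt_flipd dsrc_flipd dsgn_in_flipd dsgn_out_flipd t eqxx eq_sym.
by rewrite /edges map_rev rev_uniq -map_comp (eq_map (_ : _ =1 fst)).
Qed.

Lemma ab_rev b c x y p :
  ab_ditrail b c x y p -> ab_ditrail c b y x (rev (map flipd p)).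
Proof.
case: p => [|d p]; first by rewrite !ab_ditrail_nil eq_sym => /andP[->]; rewrite eq_sym.
rewrite ab_ditrail_cons => /and5P[/trail_rev tr sx ty sb tc].
have: flipd (last d p) = head (flipd d) (rev (map flipd (d :: p))).
  have hr T (z : T) s : head z (rev s) = last z s.
    by case/lastP: s => // s t; rewrite rev_rcons last_rcons.
  by rewrite hr /= last_map.
have: last (flipd d) (rev (map flipd (d :: p))) = flipd d.
  by rewrite map_cons rev_cons last_rcons.
have: rev (map flipd (d :: p)) != [::] by rewrite -size_eq0 size_rev.
case: (rev _) tr => //= d' q tr _ l h; rewrite ab_ditrail_cons tr l -h.
by rewrite dsrc_flipd dtgt_flipd dsgn_out_flipd dsgn_in_flipd sx ty sb tc.
Qed.

Lemma dtgt_belast d0 p :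
  path link d0 p -> [seq dtgt d | d <- belast d0 p] = [seq dsrc d | d <- p].
Proof. by elim: p d0 => //= d1 p IH d0 /andP[/andP[/eqP-> _] /IH->]. Qed.

Lemma path_src d0 p d :
  path link d0 p -> d \in p -> dsrc d \in [seq dtgt d | d <- belast d0 p].
Proof. by move=> /dtgt_belast->; exact: map_f. Qed.

Lemma avoid_belast r d0 p : path link d0 p ->
  all (fun d => dtgt d \notin [set r]) (belast d0 p) = all (fun d => dsrc d != r) p.
Proof.
by elim: p d0 => //= d1 p IH d0 /andP[/andP[/eqP<- _] /IH->]; rewrite inE.
Qed.

Lemma hit_prefix X d p :
  trail (d :: p) -> dtgt (last d p) \in X ->
  exists p1 p2, p = p1 ++ p2 /\ hit X d p1.
Proof.
move=> tr lX; suff [p1 [p2 [e h l]]] : exists p1 p2,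
    [/\ p = p1 ++ p2, all (fun d' => dtgt d' \notin X) (belast d p1)
      & dtgt (last d p1) \in X].
  exists p1, p2; split=> //; rewrite /hit h l !andbT.
  by move: tr; rewrite e -cat_cons => /trail_cat[].
elim: p d {tr} lX => [|d1 p IH] d lX; first by exists [::], [::].
have [dX|dX] := boolP (dtgt d \in X); first by exists [::], (d1 :: p).
have [p1 [p2 [e h l]]] := IH d1 lX.
by exists (d1 :: p1), p2; rewrite e /= dX.
Qed.

(** Cutting at the first visit to [r] leaves a closed ditrail over [r], so that a ban on closed
    ditrails gives control over the sign [c']. For [x = r] the prefix is trivial. *)
Lemma strict_prefix b c x r p :
  ab_ditrail b c x r p ->
  exists c' q1 q2, [/\ p = q1 ++ q2, ab_ditrail b c' x r q1,
    all (fun d => dsrc d != r) q1 & ab_ditrail (~~ c') c r r q2].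
Proof.
have [->|xr] := eqVneq x r.
  move=> ap; exists (~~ b), [::], p; rewrite ab_ditrail_nil eqxx negbK.
  by split=> //; case: (b).
case: p => [|d p]; first by rewrite ab_ditrail_nil (negPf xr).
rewrite ab_ditrail_cons => /and5P[tr /eqP sx /eqP tr' /eqP sb /eqP sc].
have [|p1 [p2 [e /and3P[tr1 h1 l1]]]] := @hit_prefix [set r] d p tr.
  by rewrite inE tr'.
exists (dsgn_in (last d p1)), (d :: p1), p2; rewrite inE in l1; split.
- by rewrite e.
- by rewrite ab_ditrail_cons tr1 sx sb l1 !eqxx.
- by rewrite /= sx xr -(@avoid_belast r d) //; case/andP: tr1.
case: p2 e => [|d2 p2] e.
  by rewrite ab_ditrail_nil eqxx -sc e cats0; case: dsgn_in.
move: tr tr' sc; rewrite e last_cat => /= tr t2 s2.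
rewrite ab_ditrail_cons t2 s2 -cat_cons in tr *; case/trail_cat: (tr) => _ -> /=.
case/andP: tr; rewrite /= cat_path /= => /and3P[_ /andP[/eqP<- +] _] _.
by rewrite l1 !eqxx !andbT; case: (dsgn_in _) (dsgn_out _) => [] [].
Qed.

Lemma hit_suffix X d p1 d2 p2 :
  hit X d (p1 ++ d2 :: p2) -> hit X d2 p2 /\ link (last d p1) d2.
Proof.
case/and3P=> tr; rewrite last_cat belast_cat all_cat => /andP[_ /= /andP[_ h2]] l2.
have [_ tr2] := @trail_cat (d :: p1) _ tr; rewrite /hit tr2 h2 l2; split=> //.
by case/andP: tr; rewrite /= cat_path /= => /and3P[].
Qed.

Lemma last_src X d p : hit X d p -> dsrc d \notin X -> dsrc (last d p) \notin X.
Proof.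
case/and3P=> /andP[sp _] /allP hp _ dX; have := mem_last d p.
by rewrite in_cons => /predU1P[-> //|/(path_src sp)/mapP[d1 /hp h ->]].
Qed.

Lemma hit1 X d : hit X d [::] = (dtgt d \in X).
Proof. by []. Qed.

Lemma belast_split (T : eqType) (x0 x : T) (s : seq T) :
  x \in belast x0 s -> exists s1 (t : T) s2,
    x0 :: s = s1 ++ x :: t :: s2 /\ belast x0 s = s1 ++ x :: belast t s2.
Proof.
elim: s x0 => //= y s IH x0; rewrite inE => /predU1P[->|/IH[s1 [z [s2 [-> ->]]]]].
  by exists [::], y, s.
by exists (x0 :: s1), z, s2.
Qed.

(* The edge of [d0] may be used again, backwards, by the last dart of [p]: then
   [d0 :: p] is a lollipop. *)
Lemma two_way d0 p w g :
  path link d0 p -> uniq (edges p) -> uniq (edges (belast d0 p)) ->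
  w \in [seq dtgt d | d <- belast d0 p] ->
  exists q, {subset edges q <= edges (d0 :: p)} /\
    (ab_ditrail g (dsgn_in (last d0 p)) w (dtgt (last d0 p)) q \/
     ab_ditrail g (dsgn_out d0) w (dsrc d0) q).
Proof.
move=> pp up ub /mapP[d1 /belast_split[s1 [d2 [s2 [e eb]]]] ->].
have: sorted link (d0 :: p) by [].
rewrite e => so; case/cat_sorted2: (so) => _ /=/andP[/andP[/eqP t12 n12] so2].
(* The walk arrives by [d1] and leaves by [d2] with opposite signs, so [g] is the first sign either
   of the forward walk from [d2] or of the backward walk from [d1]. *)
have [->|ng] := eqVneq g (dsgn_out d2).
  exists (d2 :: s2); split.
    by move=> f; rewrite /edges map_cat mem_cat /= !inE => ->; rewrite !orbT.
  left; rewrite -(last_cons d0) e last_cat /= t12; apply: trail_ab.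
  rewrite /trail [sorted _ _]so2; case: s1 e {eb so} => [[_ e]|d3 s1 [_ e]].
    by rewrite -e.
  by move: up; rewrite e -cat_rcons /edges map_cat cat_uniq => /and3P[].
have {ng} -> : g = dsgn_in d1 by case: (dsgn_in d1) (dsgn_out d2) g n12 ng => [] [] [].
exists (rev (map flipd (rcons s1 d1))); split.
  move=> f; rewrite /edges map_rev mem_rev -map_comp (eq_map (_ : _ =1 fst)) //.
  by rewrite -cat_rcons map_cat mem_cat => ->.
right; apply: ab_rev.
have tr: trail (rcons s1 d1).
  move: so ub; rewrite eb -!(cat_rcons d1) /trail => /cat_sorted2[-> _].
  by rewrite /edges map_cat cat_uniq => /andP[].
case: s1 e tr {eb so} => [[-> _]|d3 s1 [-> _]] /trail_ab //.
by rewrite last_rcons.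
Qed.

(** * Maximal vertex sets and the absorption of walks *)

Lemma maxset_ex (P : {set vert G} -> Prop) X0 :
  P X0 -> exists2 X, P X & X0 \subset X /\ forall Y, X \subset Y -> P Y -> Y = X.
Proof.
move=> P0; have /(maxset_exists (P := fun X => `[< P X >]))[X] : `[< P X0 >].
  exact/asboolP.
case/maxsetP=> /asboolP PX mX sX; exists X => //; split=> // Y XY PY.
by apply: mX => //; apply/asboolP.
Qed.

(* [K[X]] is a strong radial if [ok] is always true, and an almost strong one if
   [ok v g] excludes only [v = r], [g = -a], provided no closed (-a,-a)-ditrail
   over [r] exists. *)
Definition core (ok : vert G -> bool -> bool) a r X := forall v g,
  v \in X -> ok v g ->
  exists2 p, ab_ditrail g (~~ a) v r p & {in edges p, forall e, inside X e}.

Lemma inside_sub X Y e : X \subset Y -> inside X e -> inside Y e.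
Proof. by move=> /subsetP s /andP[/s h /s h']; apply/andP. Qed.

Lemma same_edge d d' : d.1 = d'.1 -> d = d' \/ d = flipd d'.
Proof. by case: d d' => [e []] [e' []] /= ->; [left|right|right|left]. Qed.

(* A closed walk over [X] that starts by [d0], or a lollipop whose stick is the
   edge of [d0], is absorbed by a core. *)
Lemma core_ex (ok : vert G -> bool -> bool) a r X0 :
  (forall d, ok (dtgt d) (~~ dsgn_in d)) -> core ok a r X0 ->
  exists2 X : {set vert G}, X0 \subset X /\ core ok a r X &
    forall d0 d p, dsrc d0 \in X -> dtgt d0 \notin X -> hit X d p ->
      dsrc d = dtgt d0 -> dsgn_out d = dsgn_in d0.
Proof.
move=> okP /maxset_ex[X cX [X0X mX]]; exists X => // d0 d p s0 t0 hp sd.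
have [//|neq] := eqVneq (dsgn_out d) (dsgn_in d0); case/negP: (t0).
case/and3P: hp => /andP[sp up] /allP hX lX.
(* [W] consists of the vertices of the walk [d0 :: d :: p] outside [X], among them [dtgt d0]; once
   [X :|: W] is a core, maximality of [X] is violated. *)
pose W := [set w in [seq dtgt d | d <- belast d0 (d :: p)]].
suff <- : X :|: W = X by rewrite !inE eqxx orbT.
apply: mX; first exact: subsetUl.
have pL : path link d0 (d :: p) by rewrite /= /link sd eqxx eq_sym neq.
have sL d1 : d1 \in d0 :: d :: p -> dsrc d1 \in X :|: W.
  rewrite in_cons in_setU => /predU1P[->|/(path_src pL) h]; first by rewrite s0.
  by rewrite [_ \in W]inE h orbT.
have tL d1 : d1 \in d0 :: d :: p -> dtgt d1 \in X :|: W.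
  rewrite lastI mem_rcons in_cons in_setU => /predU1P[->|h]; first by rewrite lX.
  by rewrite [_ \in W]inE map_f ?orbT.
have iL e : e \in edges (d0 :: d :: p) -> inside (X :|: W) e.
  by case/mapP=> d1 h ->; rewrite inside_dart sL ?tL.
have srcX d1 : d1 \in d :: p -> dsrc d1 \notin X.
  move=> /(path_src pL) /mapP[d2 + ->].
  by rewrite inE => /predU1P[->|/hX].
have nX e : e \in edges (d0 :: d :: p) -> ~~ inside X e.
  case/mapP=> d1; rewrite inE => /predU1P[->|/srcX/negPf h] ->.
    by rewrite inside_dart (negPf t0) andbF.
  by rewrite inside_dart h.
(* All darts of [d :: p] start outside [X], and all but the last end outside [X]; hence only the
   last one can use the edge of [d0], backwards. *)
have ub : uniq (edges (belast d0 (d :: p))).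
  have: uniq (edges (belast d p)).
    by move: up; rewrite lastI /edges map_rcons rcons_uniq => /andP[].
  rewrite /= => ->; rewrite andbT; apply/mapP=> -[d1 h /esym/same_edge[] e].
    by move/mem_belast/srcX: h; rewrite e s0.
  by move/hX: h; rewrite e dtgt_flipd s0.
move=> w g; rewrite in_setU => /orP[wX okw|].
  have [q aq iq] := cX w g wX okw; exists q => // e /iq; apply: inside_sub.
  exact: subsetUl.
rewrite inE => wW _; have [q [eq hq]] := two_way g pL up ub wW.
(* No edge of the walk lies inside [X], so when [q] ends at a vertex [y] of [X] it can be prolonged
   by a ditrail inside [X] with the fitting sign. *)
suff [c [y [yX oky aq]]] : exists c y, [/\ y \in X, ok y (~~ c) & ab_ditrail g c w y q].
  have [q' aq' iq'] := cX y _ yX oky; exists (q ++ q').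
    apply: ab_cat aq aq' _; apply/hasPn => e /iq'; rewrite !inE.
    by apply: contraL => /eq /nX.
  move=> e; rewrite /edges map_cat mem_cat => /orP[/eq/iL //|/iq'].
  by apply: inside_sub; exact: subsetUl.
case: hq => aq; first by exists (dsgn_in (last d p)), (dtgt (last d p)).
exists (dsgn_out d0), (dsrc d0); split=> //.
by have := okP (flipd d0); rewrite dtgt_flipd dsgn_in_flipd.
Qed.

End Trails.

(** * Transport of ditrails along edge maps *)

Section Maps.
Variables (A B : bigraph) (g : edge A -> edge B) (flip : edge A -> bool).
Hypothesis sgn_g : forall e b, sgn (g e) (flip e (+) b) = sgn e b.
Implicit Types (d : dart A) (p : seq (dart A)).

Definition dmap d : dart B := (g d.1, flip d.1 (+) d.2).

Lemma dsgn_out_dmap d : dsgn_out (dmap d) = dsgn_out d.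
Proof. exact: sgn_g. Qed.

Lemma dsgn_in_dmap d : dsgn_in (dmap d) = dsgn_in d.
Proof. by rewrite /dsgn_in /= -addbN sgn_g. Qed.

Lemma edges_dmap p : edges (map dmap p) = map g (edges p).
Proof. by rewrite /edges -!map_comp. Qed.

(** When a contraction or a gluing is undone or performed, incidence survives only away from the
    special vertex; [P] restricts the requirement to darts arriving at the other vertices. *)
Lemma trail_dmap (P : pred (dart A)) d p :
  injective g ->
  (forall d1 d2, P d1 -> dtgt d1 = dsrc d2 -> dtgt (dmap d1) = dsrc (dmap d2)) ->
  all P (belast d p) -> trail (d :: p) -> trail (map dmap (d :: p)).
Proof.
move=> gI Ptgt Pp /andP[sp up]; rewrite /trail edges_dmap map_inj_uniq // up andbT.
rewrite /= path_map; elim: p d Pp sp {up} => //= d2 p IH d1 /andP[P1 Pp].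
case/andP=> /andP[/eqP t n] sp; rewrite {1}/link /= (Ptgt _ _ P1 t) eqxx.
by rewrite dsgn_in_dmap dsgn_out_dmap n IH.
Qed.

Lemma trail_undmap p :
  (forall d1 d2, dtgt (dmap d1) = dsrc (dmap d2) -> dtgt d1 = dsrc d2) ->
  trail (map dmap p) -> trail p.
Proof.
move=> tgt /andP[sp]; rewrite edges_dmap => /map_uniq up; rewrite /trail up andbT.
move: sp; rewrite sorted_map; apply: sub_sorted => d1 d2 /andP[/eqP/tgt t].
by rewrite dsgn_in_dmap dsgn_out_dmap /link t eqxx.
Qed.

Variable f : vert A -> vert B.
Hypothesis endv_g : forall e b, endv (g e) (flip e (+) b) = f (endv e b).

Lemma dsrc_dmap d : dsrc (dmap d) = f (dsrc d).
Proof. exact: endv_g. Qed.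

Lemma dtgt_dmap d : dtgt (dmap d) = f (dtgt d).
Proof. by rewrite /dtgt /= -addbN endv_g. Qed.

Lemma ab_dmap b c x y p :
  injective g -> ab_ditrail b c x y p -> ab_ditrail b c (f x) (f y) (map dmap p).
Proof.
move=> gI; case: p => [|d p].
  by rewrite !ab_ditrail_nil => /andP[/eqP-> ->]; rewrite eqxx.
rewrite map_cons !ab_ditrail_cons last_map => /and5P[tr /eqP<- /eqP<- sb sc].
rewrite dsrc_dmap dtgt_dmap dsgn_out_dmap dsgn_in_dmap sb sc !eqxx !andbT -map_cons.
apply: (@trail_dmap predT) => //; last exact/allP.
by move=> d1 d2 _; rewrite dsrc_dmap dtgt_dmap => ->.
Qed.

Lemma src_dmap r p : injective f ->
  all (fun d => dsrc d != r) p -> all (fun d : dart B => dsrc d != f r) (map dmap p).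
Proof.
move=> fI; rewrite all_map; apply: sub_all => d /=.
by rewrite [dsrc (dmap d)]dsrc_dmap (inj_eq fI).
Qed.

Lemma ab_undmap b c x y p :
  injective f -> ab_ditrail b c (f x) (f y) (map dmap p) -> ab_ditrail b c x y p.
Proof.
move=> fI; case: p => [|d p].
  by rewrite !ab_ditrail_nil (inj_eq fI).
rewrite map_cons !ab_ditrail_cons last_map.
rewrite dsrc_dmap dtgt_dmap dsgn_out_dmap dsgn_in_dmap !(inj_eq fI).
case/andP=> tr ->; rewrite andbT; move: tr; rewrite -map_cons.
apply: trail_undmap => d1 d2.
by rewrite dsrc_dmap dtgt_dmap => /fI.
Qed.

Lemma hit_dmap r d p :
  injective g -> injective f ->
  hit [set f r] (dmap d) (map dmap p) = hit [set r] d p.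
Proof.
move=> gI fI; rewrite /hit last_map belast_map all_map.
have tgtE d' : (dtgt (dmap d') \in [set f r]) = (dtgt d' \in [set r]).
  by rewrite dtgt_dmap !inE (inj_eq fI).
rewrite tgtE (eq_all (a2 := fun d' => dtgt d' \notin [set r])); last first.
  by move=> d' /=; rewrite tgtE.
congr (_ && _); rewrite -map_cons; apply/idP/idP => tr.
  by apply: trail_undmap tr => d1 d2; rewrite dsrc_dmap dtgt_dmap => /fI.
apply: (@trail_dmap predT) tr => //; last exact/allP.
by move=> d1 d2 _; rewrite dsrc_dmap dtgt_dmap => ->.
Qed.

End Maps.

Lemma surj_bij (A B : finType) (f : A -> B) :
  injective f -> (forall y, exists x, f x = y) -> bijective f.
Proof.
move=> fI /fin_all_exists[h fh]; exists h => // x.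
exact/fI/fh.
Qed.

(** * Induced subgraphs, contractions, and the gluing sum they form *)

Section Subgraphs.
Variable K : bigraph.
Implicit Types (X : {set vert K}) (Q : pred (edge K)).

Lemma insideP X e b : inside X e -> endv e b \in X.
Proof. by case/andP; case: b. Qed.

Definition induced X : bigraph :=
  @Bigraph {x : vert K | x \in X} {e : edge K | inside X e}
    (fun e b => exist _ (endv (val e) b) (insideP b (valP e)))
    (fun e b => sgn (val e) b).

(** [None] is the vertex to which [X] shrinks; since the edges inside [X] are dropped, it carries no
    loop. *)
Definition contract X : bigraph :=
  @Bigraph (option {x : vert K | x \notin X}) {e : edge K | ~~ inside X e}
    (fun e b => insub (endv (val e) b))
    (fun e b => sgn (val e) b).

Definition keep Q : bigraph :=
  @Bigraph (vert K) {e : edge K | Q e}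
    (fun e b => endv (val e) b) (fun e b => sgn (val e) b).

Lemma pullback Q (p : seq (dart K)) :
  {in edges p, forall e, Q e} ->
  exists q : seq ({e | Q e} * bool), map (fun d => (val d.1, d.2)) q = p.
Proof.
elim: p => [|[e b] p IH] h; first by exists [::].
have [|q <-] := IH; first by move=> e' he; apply: h; rewrite inE he orbT.
have he : Q e by apply: h; rewrite inE eqxx.
by exists ((exist _ e he, b) :: q).
Qed.

Definition indd X : dart (induced X) -> dart K :=
  dmap (val : edge (induced X) -> edge K) xpred0.
Definition cond X : dart (contract X) -> dart K :=
  dmap (val : edge (contract X) -> edge K) xpred0.

Lemma ab_induced X b c (x y : vert (induced X)) p :
  ab_ditrail b c x y p -> ab_ditrail b c (val x) (val y) (map (@indd X) p).
Proof. by apply: ab_dmap => //; exact: val_inj. Qed.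

Lemma induced_ab X b c (x y : vert (induced X)) p :
  ab_ditrail b c (val x) (val y) p -> {in edges p, forall e, inside X e} ->
  exists q, ab_ditrail b c x y q.
Proof.
move=> ap /pullback[q eq]; exists q.
rewrite -eq in ap.
by apply: (@ab_undmap (induced X) K val xpred0 _ val) => //; exact: val_inj.
Qed.

Lemma insub_None X x : (insub x == None :> option {x : vert K | x \notin X}) = (x \in X).
Proof. by case: insubP => [u /negPf-> //|]; rewrite negbK => ->. Qed.

Lemma insub_eq X x y : x \notin X ->
  insub x = insub y :> option {x : vert K | x \notin X} -> x = y.
Proof.
move=> xX; rewrite (insubT (fun x => x \notin X) xX).
by case: insubP => // u _ <- [<-].
Qed.

Lemma dsrc_cond X (d : dart (contract X)) : dsrc d = insub (dsrc (cond d)).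
Proof. by []. Qed.
Lemma dtgt_cond X (d : dart (contract X)) : dtgt d = insub (dtgt (cond d)).
Proof. by []. Qed.

Definition apex X : vert (contract X) := None.

Lemma dtgt_cond_apex X (d : dart (contract X)) :
  (dtgt d \in [set apex X]) = (dtgt (cond d) \in X).
Proof. by rewrite in_set1 -(insub_None X). Qed.

Lemma avoid_cond X (d : dart (contract X)) p :
  all (fun d' => dtgt d' \notin X) (belast (cond d) (map (@cond X) p)) =
  all (fun d' => dtgt d' \notin [set apex X]) (belast d p).
Proof.
rewrite belast_map all_map; apply: eq_all => d'.
by rewrite dtgt_cond_apex.
Qed.

(** A ditrail through the apex need not lift, as it may enter and leave [X] at different vertices; a
    hit meets the apex only at its ends. *)
Lemma hit_lift X (d : dart (contract X)) p :
  hit [set apex X] d p -> hit X (cond d) (map (@cond X) p).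
Proof.
case/and3P=> tr hp; rewrite dtgt_cond_apex => l.
rewrite /hit last_map l avoid_cond hp !andbT.
rewrite -map_cons; apply: trail_dmap hp tr => //; first exact: val_inj.
move=> d1 d2; rewrite dtgt_cond_apex; exact: insub_eq.
Qed.

Lemma hit_push X d p :
  hit X d p -> {in edges (d :: p), forall e, ~~ inside X e} ->
  exists d' p', [/\ cond d' = d, map (@cond X) p' = p & hit [set apex X] d' p'].
Proof.
move=> + /pullback[[|d' p'] //= [ed ep]]; rewrite -ed -ep.
rewrite -/(cond d') -/(map (@cond X) p') => /and3P[tr hp l].
exists d', p'; split=> //; rewrite /hit dtgt_cond_apex -avoid_cond hp.
move: l; rewrite (last_map (@cond X)) => ->; rewrite !andbT.
apply: (@trail_undmap (contract X) K val xpred0) => // d1 d2 e.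
by rewrite dtgt_cond [dtgt _]e.
Qed.

Lemma hit_outside X (d : dart K) p :
  hit X d p -> dsrc d \notin X -> {in edges (d :: p), forall e, ~~ inside X e}.
Proof.
case/and3P=> /andP[/= sp _] /allP hp _ dX e he.
have /mapP[d' + ->] : e \in edges (d :: p) by [].
rewrite inside_dart in_cons => /predU1P[->|/(path_src sp)/mapP[d1 /hp h ->]].
  by rewrite (negPf dX).
by rewrite (negPf h).
Qed.

Lemma card_contract X : #|vert (contract X)| = #|~: X|.+1.
Proof.
by rewrite card_option card_sig; congr _.+1; apply: eq_card => x; rewrite !inE.
Qed.

Lemma contract_lt X x y :
  x \in X -> y \in X -> x != y -> #|vert (contract X)| < #|vert K|.
Proof.
move=> xX yX xy; rewrite card_contract -(cardsC X).
have: [set x; y] \subset X by rewrite subUset !sub1set xX.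
by move/subset_leq_card; rewrite cards2 xy => h; rewrite -add2n leq_add2r.
Qed.

(** [K] is recovered from [contract X] and [induced X] by putting each edge end at the apex back
    where it was. When [T] omits only the root, the hypothesis says that every edge at the root lies
    inside [X]. *)
Lemma gluing_contract X (r0 : vert (induced X)) (T : {set vert (induced X)}) :
  (forall e b (x : vert (induced X)), ~~ inside X e -> endv e b = val x -> x \in T) ->
  gluing_sum (apex X) T val.
Proof.
move=> hT; pose att (e : edge (contract X)) b : vert (induced X) :=
  insubd r0 (endv (val e) b).
have attE (e : edge (contract X)) b : endv e b = apex X -> val (att e b) = endv (val e) b.
  by by move/eqP; rewrite [endv e b]/= insub_None => h; rewrite /att insubdK.
exists att; split=> [e b /attE/esym|]; first exact: hT (valP e).
(* [val r0] is only a default: [u] differs from the apex, so [val u] is never [None]. *)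
pose f (v : vert (glue (apex X) att)) : vert K := match v with
  | inl u => if val u is Some v then val v else val r0
  | inr x => val x end.
pose h (e : edge (glue (apex X) att)) : edge K := match e with
  | inl u => val u | inr x => val x end.
exists f; split=> //; split.
  apply: surj_bij => [[[[u|] pu]|x] [[[v|] pv]|y] //=|x].
  - by move/val_inj=> uv; congr inl; apply: val_inj; rewrite /= uv.
  - by move=> e; move: (valP u); rewrite /= e (valP y).
  - by move=> e; move: (valP v); rewrite /= -e (valP x).
  - by move/val_inj->.
  have [xX|xX] := boolP (x \in X); first by exists (inr (exist _ x xX)).
  pose u : vert (contract X) := Some (exist _ x xX).
  by exists (inl (exist (fun v => v != apex X) u isT)).
exists h, xpred0; split.
  apply: surj_bij => [[u|u] [v|v] /= e|e].
  - by congr inl; exact: val_inj.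
  - by move: (valP u); rewrite /= e (valP v).
  - by move: (valP v); rewrite /= -e (valP u).
  - by congr inr; exact: val_inj.
  have [eX|eX] := boolP (inside X e); first by exists (inr (exist _ e eX)).
  by exists (inl (exist _ e eX)).
case=> [e|e] b /=; split=> //; case: insubP => [[[v|] //= pv] _ eu|].
  by move: eu; case: insubP => // w _ <- [->].
by rewrite negbK => /eqP/attE/esym.
Qed.

End Subgraphs.

(** * Ditrails in gluing sums, and reachability of the root *)

(** A ditrail of [G] meeting [s] only at its end becomes one ending at some [t] in [T]; any ditrail
    of [H] from [t] with the fitting sign continues it, since the two use different edges. Avoidance
    of [r] is tracked because the sum may in turn be the first summand of another gluing. *)
Lemma gluing_ditrails (G : bigraph) (s : vert G) (H : bigraph) (T : {set vert H})
    (K : bigraph) (i : vert H -> vert K) :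
  gluing_sum s T i ->
  (forall b c x y q, ab_ditrail b c x y q ->
     exists2 q', ab_ditrail b c (i x) (i y) q'
     & forall r, all (fun d => dsrc d != r) q -> all (fun d => dsrc d != i r) q') /\
  (forall v, (exists w, v = i w) \/
     exists u, forall b c p, ab_ditrail b c u s p -> all (fun d => dsrc d != s) p ->
       exists2 t, t \in T & forall e y q, ab_ditrail (~~ c) e t y q ->
         exists2 q', ab_ditrail b e v (i y) q'
         & forall r, all (fun d => dsrc d != r) q -> all (fun d => dsrc d != i r) q').
Proof.
case=> att [attT [f [[fb [g [flip [gb gE]]]] iE]]].
have fI := bij_inj fb; have gI := bij_inj gb.
have iI : injective i by move=> x y; rewrite !iE => /fI[].
pose gH (e : edge H) := g (inr e); pose fH (e : edge H) := flip (inr e).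
have gHI : injective gH by move=> e e' /gI[].
have sH e b : sgn (gH e) (fH e (+) b) = sgn e b by have [] := gE (inr e) b.
have eH e b : endv (gH e) (fH e (+) b) = i (endv e b).
  by rewrite iE; have [-> _] := gE (inr e) b.
have mapH b c x y q : ab_ditrail b c x y q ->
    ab_ditrail b c (i x) (i y) (map (dmap gH fH) q).
  exact: ab_dmap.
have srcH r q : all (fun d => dsrc d != r) q ->
    all (fun d => dsrc d != i r) (map (dmap gH fH) q).
  exact: src_dmap.
split=> [b c x y q /mapH ?|v].
  by exists (map (dmap gH fH) q) => // r; exact: srcH.
pose gG (e : edge G) := g (inl e); pose fG (e : edge G) := flip (inl e).
have gGI : injective gG by move=> e e' /gI[].
have sG e b : sgn (gG e) (fG e (+) b) = sgn e b by have [] := gE (inl e) b.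
pose F := dmap gG fG.
have srcF d : dsrc (F d) =
    f (if insub (dsrc d) is Some u then inl u else inr (att d.1 d.2)).
  by have [] := gE (inl d.1) d.2.
have tgtF d : dtgt (F d) =
    f (if insub (dtgt d) is Some u then inl u else inr (att d.1 (~~ d.2))).
  by rewrite /dtgt /= -addbN; have [] := gE (inl d.1) (~~ d.2).
case: fb => f' fK f'K; rewrite -[v]f'K; case: (f' v) => [u|w]; last first.
  by left; exists w; rewrite iE.
right; exists (val u) => b c [|d p].
  by rewrite ab_ditrail_nil (negPf (valP u)).
rewrite ab_ditrail_cons => /and5P[tr /eqP su /eqP ts sb sc] src.
exists (att (last d p).1 (~~ (last d p).2)); first exact: attT.
move=> e y q aq; exists (map F (d :: p) ++ map (dmap gH fH) q); last first.
  move=> r /srcH; rewrite all_cat => ->; rewrite andbT.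
  rewrite all_map; apply: sub_all src => d' /= nd; rewrite srcF.
  by rewrite insubT; apply/eqP; rewrite iE => /fI.
apply: ab_cat (mapH _ _ _ _ _ aq) _.
  rewrite map_cons ab_ditrail_cons srcF su valK eqxx last_map tgtF ts.
  rewrite insubF ?eqxx // iE eqxx.
  rewrite (dsgn_out_dmap sG) (dsgn_in_dmap sG) sb sc !andbT -map_cons.
  have pp : path (@link G) d p by case/andP: tr.
  apply: (@trail_dmap _ _ _ _ _ (fun d => dtgt d \notin [set s])) tr => //.
    by move=> d1 d2 ; rewrite inE => n e12; rewrite [LHS]tgtF [RHS]srcF -e12 insubT.
  by rewrite avoid_belast //; case/andP: src.
apply/hasPn => ? /mapP[? /mapP[d1 _ ->] ->]; apply/mapP => -[? /mapP[d2 _ ->]].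
by move/gI.
Qed.

Scheme calR_mut := Minimality for calR Sort Prop
  with calL_mut := Minimality for calL Sort Prop.
Combined Scheme cal_mut from calR_mut, calL_mut.

(** If the first visit to [r] came with sign [a], the rest of the ditrail would be a forbidden
    closed one with signs [~~ a] at both ends. *)
Lemma strict_of_almost_strong a (G : bigraph) (r : vert G) g v :
  almost_strong_radial a r -> (v == r) ==> (g == a) ->
  exists2 p, ab_ditrail g (~~ a) v r p & all (fun d => dsrc d != r) p.
Proof.
case=> rad str clo; have [->|vr /= _] := eqVneq v r.
  by move=> /eqP ->; exists [::]; rewrite // ab_ditrail_nil eqxx; case: (a).
have [p ap] : exists p, ab_ditrail g (~~ a) v r p.
  have [->|ga] := eqVneq g a; first exact: rad.
  by rewrite (_ : g = ~~ a); [exact: str|case: (g) (a) ga => [] []].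
have [c [q [q' [_ aq sq aq']]]] := strict_prefix ap.
exists q => //; have [<- //|nc] := eqVneq c (~~ a).
have ca : c = a by case: (c) (a) nc => [] [].
by case: clo; exists q'; rewrite ca in aq'.
Qed.

(** Meeting the root only at the end is what the next gluing requires. The arrival sign is
    prescribed for [calR] only: an almost strong [H] offers both departure signs at [t], so it copes
    with the unknown sign from [calL], whereas a linear [H] is only asked for sign [a], which fits
    the arrival sign [~~ a] from [calR]. *)
Lemma cal_reach a :
  (forall (G : bigraph) (r : vert G), calR a r -> forall v,
     exists2 p, ab_ditrail a (~~ a) v r p & all (fun d => dsrc d != r) p) /\
  (forall (G : bigraph) (r : vert G), calL a r -> forall v, exists b,
     exists2 p, ab_ditrail a b v r p & all (fun d => dsrc d != r) p).
Proof.
apply: cal_mut.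
- by move=> G r as_r v; apply: strict_of_almost_strong as_r _; rewrite eqxx implybT.
- move=> G r J v c K f _ IH [fb [g [flip [gb gE]]]] w.
  case: (fb) => f' _ f'K; rewrite -(f'K w); have [p ap sp] := IH (f' w).
  pose gG (e : edge G) := g (inl e); pose fG (e : edge G) := flip (inl e).
  have sG e b : sgn (gG e) (fG e (+) b) = sgn e b by have [] := gE (inl e) b.
  have eG e b : endv (gG e) (fG e (+) b) = f (endv e b) by have [] := gE (inl e) b.
  exists (map (dmap gG fG) p).
    by apply: ab_dmap ap => // e e' /(bij_inj gb)[].
  by apply: src_dmap sp => //; exact: bij_inj fb.
- move=> G s H r K i _ IH as_r /gluing_ditrails[mapH cases] v.
  have [[w ->]|[u hu]] := cases v.
    have [|q /mapH[q' aq sq] /sq] := @strict_of_almost_strong a H r a w as_r.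
      by rewrite eqxx implybT.
    by exists q'.
  have [b [p ap /(hu _ _ _ ap)[t tr ht]]] := IH u.
  rewrite !inE in tr.
  have [|q /ht[q' aq sq] /sq] := @strict_of_almost_strong a H r (~~ b) t as_r.
    by rewrite (negPf tr).
  by exists q'.
- move=> G r [sr _ _] v; have [p] := sr v.
  by case/orP=> /strict_prefix[c [q [_ [_ aq sq _]]]]; exists c, q.
move=> G s H r K i _ IH [sr _ _] /gluing_ditrails[mapH cases] v.
have sH w : exists b, exists2 p, ab_ditrail a b w r p & all (fun d => dsrc d != r) p.
  have [p] := sr w.
  by case/orP=> /strict_prefix[c [q [_ [_ aq sq _]]]]; exists c, q.
have [[w ->]|[u hu]] := cases v.
  by have [b [q /mapH[q' aq sq] /sq]] := sH w; exists b, q'.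
have [p ap /(hu _ _ _ ap)[t tr ht]] := IH u; rewrite negbK in ht.
by have [b [q /ht[q' aq sq] /sq]] := sH t; exists b, q'.
Qed.

(** * Sufficient conditions for membership in the two classes *)

Section Shapes.
Variable a : bool.

(* These characterise membership in L^a(r) and R^a(r), but only sufficiency is
   needed. *)
Definition L_shape (K : bigraph) (r : vert K) : Prop :=
  [/\ forall v, v != r ->
        exists d p, [/\ hit [set r] d p, dsrc d = v & dsgn_out d = a],
      forall d, dsrc d = r -> dtgt d <> r
    & forall d0 d p, dsrc d0 = r -> hit [set r] d p -> dsrc d = dtgt d0 ->
        dsgn_out d = a].

Definition R_shape (K : bigraph) (r : vert K) : Prop :=
  [/\ forall v, v != r -> exists d p,
        [/\ hit [set r] d p, dsrc d = v, dsgn_out d = a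
          & dsgn_in (last d p) = ~~ a],
      forall d p, hit [set r] d p -> dsrc d = r -> dsgn_out d = ~~ a ->
        dsgn_in (last d p) = a
    & forall d0, dsrc d0 = r -> dsgn_out d0 = ~~ a -> dtgt d0 <> r -> exists d p,
        [/\ hit [set r] d p, dsrc d = dtgt d0, dsgn_out d = ~~ a
          & dsgn_in (last d p) = ~~ a]].

Lemma cond_notin (K : bigraph) (X : {set vert K}) (d : dart (contract X)) :
  dsrc (cond d) \in X -> dtgt (cond d) \notin X.
Proof.
move=> sX; have := valP d.1; rewrite -/(cond d).1.
by rewrite (inside_dart X (cond d)) sX.
Qed.

Lemma src_apex (K : bigraph) (X : {set vert K}) (d : dart (contract X)) :
  dsrc d = apex X -> dsrc (cond d) \in X.
Proof. by move/eqP; rewrite dsrc_cond insub_None. Qed.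

(** The second hypothesis is the maximality property from [core_ex]: all hits from a neighbour of
    [X] leave with one common sign, which the first hypothesis identifies as [a]. *)
Lemma contract_L_shape (K : bigraph) (X : {set vert K}) :
  (forall v, v \notin X ->
     exists d p, [/\ hit X d p, dsrc d = v & dsgn_out d = a]) ->
  (forall d0 d p, dsrc d0 \in X -> dtgt d0 \notin X -> hit X d p ->
      dsrc d = dtgt d0 -> dsgn_out d = dsgn_in d0) ->
  L_shape (apex X).
Proof.
move=> hX mX; split.
- case=> [u|] // _; have [d [p [hd sd od]]] := hX _ (valP u).
  have [|d' [p' [ed _ hd']]] := hit_push hd.
    by apply: hit_outside hd _; rewrite sd (valP u).
  exists d', p'; split=> //; first by rewrite dsrc_cond ed sd valK.
  by rewrite -od -ed.
- by move=> d /src_apex/cond_notin + /eqP; rewrite dtgt_cond insub_None => /negPf->.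
move=> d0 d p /src_apex s0 /hit_lift hd e; have t0 := cond_notin s0.
have e' : dsrc (cond d) = dtgt (cond d0).
  by apply/esym; apply: insub_eq t0 _; rewrite -dtgt_cond -e.
have [d1 [p1 [h1 s1 <-]]] := hX _ t0.
by rewrite [LHS](mX _ _ _ s0 t0 hd e') -(mX _ _ _ s0 t0 h1 s1).
Qed.

Lemma a_ditrail_ex (K : bigraph) b (x y : vert K) p :
  a_ditrail b x y p <-> exists c, ab_ditrail b c x y p.
Proof.
split=> [/orP[]|[[] h]]; [by exists true|by exists false| |];
  by rewrite /a_ditrail h ?orbT.
Qed.

(** Here every edge end at [r] has sign [~~ a], so a closed ditrail leaving [r] would, at its first
    return, contradict the second property of [R_shape]. Hence a maximal core is almost strong. *)
Lemma R_shape_calR_neg (K : bigraph) (r : vert K) :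
  (forall (G : bigraph) (s : vert G), #|vert G| < #|vert K| -> L_shape s -> calL a s) ->
  R_shape r -> (forall d, dtgt d = r -> dsgn_in d = ~~ a) -> calR a r.
Proof.
move=> IH [R1 R2 R3] neg.
have noclo : ~ exists p, ab_ditrail (~~ a) (~~ a) r r p.
  case=> -[|d p]; first by rewrite ab_ditrail_nil => /andP[_]; rewrite eqxx.
  rewrite ab_ditrail_cons => /and5P[tr /eqP sd /eqP td /eqP od _].
  have [|p1 [p2 [_ h1]]] := @hit_prefix _ [set r] d p tr; first by rewrite inE td.
  have := R2 _ _ h1 sd od; case/and3P: h1 => _ _; rewrite inE => /eqP/neg->.
  by case: (a).
have [/forallP all_r|] := boolP [forall v, v == r].
  apply: calR_base; split=> // v; rewrite (eqP (all_r v)) ?eqxx //.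
  by exists [::]; rewrite ab_ditrail_nil eqxx; case: (a).
rewrite negb_forall => /existsP[v0 v0r].
pose ok v g := (v != r) || (g == a).
have okP d : ok (dtgt d) (~~ dsgn_in d).
  by rewrite /ok; case: eqVneq => // /neg->; rewrite negbK eqxx.
have [|X [rX cX] mX] := @core_ex _ ok a r [set r] okP.
  move=> v g; rewrite inE => /eqP->; rewrite /ok eqxx => /eqP->.
  by exists [::]; rewrite // ab_ditrail_nil eqxx; case: (a).
rewrite sub1set in rX.
have to_X g v d p : hit [set r] d p -> dsrc d = v -> dsgn_out d = g ->
    exists d p, [/\ hit X d p, dsrc d = v & dsgn_out d = g].
  case/and3P=> tr _; rewrite inE => /eqP l sd od.
  have [|p1 [p2 [_ h1]]] := @hit_prefix _ X d p tr; first by rewrite l.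
  by exists d, p1.
(* A neighbour of [r] outside [X] would have hits of [X] leaving with both signs, by the first and
   third properties of [R_shape], while maximality of [X] allows only one sign. *)
have nbr d : dsrc d = r -> dtgt d \in X.
  move=> sd; apply/negPn/negP => tX.
  have tr : dtgt d != r by apply: contraNneq tX => ->.
  have od : dsgn_out d = ~~ a.
    by rewrite -dsgn_in_flipd; apply: neg; rewrite dtgt_flipd.
  have sX : dsrc d \in X by rewrite sd.
  have [d1 [p1 [h1 s1 o1 _]]] := R1 _ tr.
  have [d2 [p2 [h2 s2 o2 _]]] := R3 _ sd od (elimN eqP tr).
  have [d3 [p3 [h3 s3 o3]]] := to_X _ _ _ _ h1 s1 o1.
  have [d4 [p4 [h4 s4 o4]]] := to_X _ _ _ _ h2 s2 o2.
  have := mX _ _ _ sX tX h4 s4; rewrite -(mX _ _ _ sX tX h3 s3) o3 o4.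
  by case: (a).
pose rH : vert (induced X) := exist _ r rX.
have as_H : almost_strong_radial a rH.
  split=> [v|v vr|[p /ab_induced ap]].
  - have [|p ap ip] := cX (val v) a (valP v); first by rewrite /ok eqxx orbT.
    exact: (@induced_ab _ _ _ _ v rH _ ap ip).
  - have [|p ap ip] := cX (val v) (~~ a) (valP v).
      by rewrite /ok (_ : val v != r) //; apply: contraNneq vr => vr; apply/eqP/val_inj.
    exact: (@induced_ab _ _ _ _ v rH _ ap ip).
  - by apply: noclo; exists (map (@indd _ X) p).
have LG : L_shape (apex X).
  apply: contract_L_shape mX => v vX.
  have [|d [p [h s o _]]] := R1 v; first by apply: contraNneq vX => ->.
  exact: to_X h s o.
(* The last dart of a hit exhibits a neighbour of [r] other than [r]; it lies in [X], so [X] has at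
   least two vertices. *)
have lt : #|vert (contract X)| < #|vert K|.
  have [d [p [h s _ _]]] := R1 _ v0r.
  have : dsrc (last d p) \notin [set r] by apply: last_src h _; rewrite s inE.
  rewrite inE => zr; case/and3P: h => _ _; rewrite inE => /eqP tl.
  apply: (contract_lt (nbr (flipd (last d p)) tl) rX).
  by rewrite dtgt_flipd.
apply: (@calR_glue a _ _ _ rH K val (IH _ _ lt LG) as_H).
apply: gluing_contract => [|e b x ni ex]; first exact: rH.
rewrite !inE; apply: contraNneq ni => xr.
have sd : dsrc (e, b) = r by rewrite /dsrc /= ex xr.
by rewrite -[e]/(e, b).1 inside_dart nbr // sd rX.
Qed.

(** Edges over which [r] has sign [a] are deleted and put back by [calR_add]. The hits that
    [R_shape] requires start away from [r] and arrive with sign [~~ a], so they survive the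
    deletion. *)
Lemma R_shape_calR (K : bigraph) (r : vert K) :
  (forall (G : bigraph) (s : vert G), #|vert G| < #|vert K| -> L_shape s -> calL a s) ->
  R_shape r -> calR a r.
Proof.
move=> IH [R1 R2 R3].
pose Q e := [forall b, (endv e b == r) ==> (sgn e b != a)].
pose F := dmap (val : edge (keep Q) -> edge K) xpred0.
have hitF d p : hit [set r] (F d) (map F p) = hit [set (r : vert (keep Q))] d p.
  by apply: (@hit_dmap (keep Q) K val xpred0 _ id) => //; exact: val_inj.
have to_F d p : hit [set r] d p -> dsrc d != r -> dsgn_in (last d p) = ~~ a ->
    exists d' p', [/\ F d' = d, map F p' = p & hit [set (r : vert (keep Q))] d' p'].
  move=> h sd il; have : {in edges (d :: p), forall e, Q e}.
    move=> e /mapP[d1 hd1 ->]; apply/forallP => b; apply/implyP => /eqP e1.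
    case/and3P: (h) => /andP[sp _] /allP hp _.
    have sd1 : dsrc d1 != r.
      move: hd1; rewrite in_cons => /predU1P[-> //|/(path_src sp)/mapP[d2 /hp h2 ->]].
      by rewrite inE in h2.
    have [b1|/negPf b1] := eqVneq b d1.2; first by rewrite /dsrc -b1 e1 eqxx in sd1.
    have {b1} bE : b = ~~ d1.2 by case: (b) (d1.2) b1 => [] [].
    have td1 : dtgt d1 = r by rewrite /dtgt -bE.
    move: hd1; rewrite lastI mem_rcons in_cons => /predU1P[d1E|/hp].
      by move: il; rewrite -d1E /dsgn_in -bE => ->; case: (a).
    by rewrite td1 inE eqxx.
  case/pullback => -[|d' p'] // [ed ep]; exists d', p'; split=> //.
  by rewrite -hitF [F d']ed [map F p']ep.
have RK : R_shape (r : vert (keep Q)).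
  split.
  - move=> v vr; have [d [p [h s o il]]] := R1 v vr.
    have [|d' [p' [ed ep h']]] := to_F d p h _ il; first by rewrite s.
    exists d', p'; split=> //.
    - by rewrite [LHS]/(dsrc (F d')) ed.
    - by rewrite [LHS]/(dsgn_out (F d')) ed.
    by rewrite -[LHS]/(dsgn_in (F (last d' p'))) -last_map ed ep.
  - move=> d p; rewrite -hitF => h s o; have := R2 _ _ h s o.
    by rewrite last_map.
  move=> d0 s0 o0 t0; have [d [p [h s o il]]] := R3 (F d0) s0 o0 t0.
  have [|d' [p' [ed ep h']]] := to_F d p h _ il; first by rewrite s; apply/eqP.
  exists d', p'; split=> //.
  - by rewrite [LHS]/(dsrc (F d')) ed.
  - by rewrite [LHS]/(dsgn_out (F d')) ed.
  by rewrite -[LHS]/(dsgn_in (F (last d' p'))) -last_map ed ep.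
have cK : calR a (r : vert (keep Q)).
  apply: R_shape_calR_neg => // -[e b] te; have /forallP/(_ (~~ b)) := valP e.
  rewrite [endv _ _](te : _ = r) eqxx /dsgn_in /=.
  by case: (sgn _ _) (a) => [] [].
(* For a deleted edge, [br e] names an end at which [r] has sign [a]. As [add_edges] puts [r] at end
   [false], [br] is also the flip of the isomorphism. *)
pose br e := (endv e true == r) && (sgn e true == a).
have brP e : ~~ Q e -> endv e (br e) = r /\ sgn e (br e) = a.
  rewrite negb_forall => /existsP[b]; rewrite negb_imply negbK => /andP[er es].
  rewrite /br; case: andP => [[/eqP-> /eqP->] //|nt].
  by case: b er es => [er es|/eqP-> /eqP->]; first by case: nt.
pose v (j : {e | ~~ Q e}) : vert (keep Q) := endv (val j) (~~ br (val j)).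
pose c (j : {e | ~~ Q e}) := sgn (val j) (~~ br (val j)).
apply: (@calR_add a (keep Q) r _ v c K id cK).
split; first by exists id.
exists (fun e => match e with inl e => val e | inr j => val j end).
exists (fun e => match e with inl e => false | inr j => br (val j) end).
split.
  apply: surj_bij => [[u|u] [w|w] /= e|e].
  - by congr inl; exact: val_inj.
  - by move: (valP w); rewrite /= -e (valP u).
  - by move: (valP u); rewrite /= e (valP w).
  - by congr inr; exact: val_inj.
  have [eX|eX] := boolP (Q e); first by exists (inl (exist _ e eX)).
  by exists (inr (exist _ e eX)).
case=> [e|j] b //=; have [e1 e2] := brP _ (valP j).
by case: b; rewrite ?addbT ?addbF.
Qed.

Lemma L_shape_calL (K : bigraph) (r : vert K) :
  (forall (G : bigraph) (s : vert G), #|vert G| < #|vert K| -> R_shape s -> calR a s) ->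
  L_shape r -> calL a r.
Proof.
move=> IH [L1 L2 L3].
have [/forallP all_r|] := boolP [forall v, v == r].
  apply: calL_base; split=> [v||x [|d p] //].
  - exists [::]; apply/a_ditrail_ex; exists (~~ a).
    by rewrite (eqP (all_r v)) ab_ditrail_nil eqxx; case: (a).
  - by case=> e le; apply: (L2 (e, true)); rewrite ?/dsrc ?/dtgt le.
  by case: (L2 d); exact/eqP/all_r.
rewrite negb_forall => /existsP[v0 v0r].
pose N v := forall d p, hit [set r] d p -> dsrc d = v -> dsgn_out d = a.
(* The reverse of a dart leaving [r] is by itself a hit from a neighbour of [r]. *)
have in_nbr d : dsrc d = r -> dsgn_in d = a.
  move=> sd; rewrite -dsgn_out_flipd; apply: (L3 d _ [::] sd) => //.
  by rewrite hit1 dtgt_flipd sd inE.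
have Nr : N r.
  move=> d [|d1 p] h sd; first by case: (L2 d sd); move: h; rewrite hit1 inE => /eqP.
  have [h1 /andP[/eqP td]] := @hit_suffix _ _ d [::] _ _ h.
  by rewrite /= in_nbr // (L3 d d1 p) ?eqxx.
(* The condition [N] will make [induced X] linear, the ditrails inside [X] will make it a
   semiradial. *)
pose Psi (X : {set vert K}) := forall v, v \in X -> N v /\
  exists b, exists2 p, ab_ditrail a b v r p & {in edges p, forall e, inside X e}.
have [|X PX [rX mX]] := @maxset_ex _ Psi [set r].
  move=> v; rewrite inE => /eqP->; split=> //; exists (~~ a), [::] => //.
  by rewrite ab_ditrail_nil eqxx; case: (a).
rewrite sub1set in rX.
have ext d : dtgt d \in X -> N (dsrc d) -> dsgn_out d = a ->
    dtgt d = r \/ dsgn_in d = ~~ a -> dsrc d \in X.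
  move=> tX Nd od dr; apply/negPn/negP => sX; case/negP: (sX).
  suff <- : dsrc d |: X = X by rewrite !inE eqxx.
  apply: mX; first exact: subsetUr.
  move=> w; rewrite in_setU1 => /predU1P[->|/PX[Nw [b [p ap ip]]]]; last first.
    split=> //; exists b, p => // e /ip; apply: inside_sub; exact: subsetUr.
  split=> //.
  have [b [q aq iq]] : exists b, exists2 q, ab_ditrail (~~ dsgn_in d) b (dtgt d) r q
      & {in edges q, forall e, inside X e}.
    case: dr => [->|->]; last by rewrite negbK; case: (PX _ tX).
    by exists (dsgn_in d), [::] => //; rewrite ab_ditrail_nil eqxx; case: dsgn_in.
  exists b, (d :: q).
    apply: (@ab_cat _ a _ b _ _ _ [:: d] q _ aq).
      by rewrite ab_ditrail_cons od !eqxx.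
    apply/hasPn => e /iq; apply: contraL; rewrite /edges /= inE => /eqP->.
    by rewrite inside_dart (negPf sX).
  move=> e; rewrite in_cons => /predU1P[->|/iq]; last first.
    by apply: inside_sub; exact: subsetUr.
  by rewrite inside_dart !in_setU1 eqxx tX orbT.
have nbr d : dsrc d = r -> dtgt d \in X.
  move=> sd; apply: (ext (flipd d)); rewrite ?dtgt_flipd ?sd //.
  - by move=> d1 p; exact: (L3 d).
  - by rewrite dsgn_out_flipd in_nbr.
  by left.
pose rH : vert (induced X) := exist _ r rX.
have lin_H : linear_semiradial a rH.
  split=> [v|[e le]|x [|d p] // /a_ditrail_ex[b /ab_induced]].
  - have [_ [b [p ap ip]]] := PX _ (valP v).
    have [q aq] := @induced_ab _ _ _ _ v rH _ ap ip.
    by exists q; apply/a_ditrail_ex; exists b.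
  - apply: (L2 (val e, true)); [have := le true|have := le false]; by move/(congr1 val).
  have [Nx _] := PX _ (valP x).
  rewrite map_cons ab_ditrail_cons => /and5P[tr /eqP sd /eqP td /eqP od _].
  have [|p1 [p2 [_ h1]]] := hit_prefix (X := [set r]) tr; first by rewrite inE td.
  by have := Nx _ _ h1 sd; rewrite od; case: (a).
(* The first vertex of [X] on the hit is not [r], whose neighbours all lie in [X]. The hit therefore
   continues to [r] from a vertex satisfying [N], hence with sign [a], so it entered [X] with
   [~~ a]. *)
have arrive v d p : v \notin X -> hit [set r] d p -> dsrc d = v ->
    exists p1, hit X d p1 /\ dsgn_in (last d p1) = ~~ a.
  move=> vX h sd; case/and3P: (h) => tr _ lr.
  have [|p1 [p2 [e h1]]] := @hit_prefix _ X d p tr.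
    by move: lr; rewrite inE => /eqP->.
  exists p1; split=> //; have lX := last_src h1; rewrite sd in lX.
  case/and3P: (h1) => _ _ yX.
  have yr : dtgt (last d p1) <> r.
    move=> yr; case/negP: (lX vX); rewrite -dtgt_flipd; exact: nbr.
  case: p2 e => [|d2 p2] e; first by case: yr; move: lr; rewrite e cats0 inE => /eqP.
  rewrite e in h; have [h2 /andP[/eqP t2]] := hit_suffix h.
  have [Ny _] := PX _ yX; rewrite (Ny _ _ h2 (esym t2)).
  by case: dsgn_in (a) => [] [].
have RG : R_shape (apex X).
  have push d p : hit X d p -> dsrc d \notin X -> exists d' p',
      [/\ hit [set apex X] d' p', dsrc d' = insub (dsrc d),
        dsgn_out d' = dsgn_out d & dsgn_in (last d' p') = dsgn_in (last d p)].
    move=> h sX; have [d' [p' [ed ep h']]] := hit_push h (hit_outside h sX).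
    exists d', p'; split=> //; rewrite ?dsrc_cond -ed //.
    by rewrite -ep last_map.
  split.
  - case=> [u|] // _; have ur : val u != r by apply: contraNneq (valP u) => ->.
    have [d [p [h s o]]] := L1 _ ur.
    have [p1 [h1 i1]] := arrive _ _ _ (valP u) h s.
    have [|d' [p' [h' s' o' i']]] := push _ _ h1; first by rewrite s (valP u).
    by exists d', p'; rewrite s' s valK o' i'.
  - move=> d p h /src_apex sX od; have := hit_lift h; set d1 := cond d => h1.
    have [//|il] := eqVneq (dsgn_in (last d p)) a.
    have {}il : dsgn_in (last d p) = ~~ a by case: dsgn_in (a) il => [] [].
    have tX : dtgt (last d1 (map (@cond _ X) p)) \in X by case/and3P: h1.
    (* Arriving in [X] with [~~ a], the lifted hit can be continued inside [X] to [r]; as it left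
       [X] with [~~ a], this contradicts [N] at its start. *)
    have [_ [b [q aq iq]]] := PX _ tX; have aq' := aq; rewrite -{1}[a]negbK in aq'.
    have [Nx _] := PX _ sX; case/and3P: h1 => tr1 _ _.
    have ap : ab_ditrail (~~ a) b (dsrc d1) r ((d1 :: map (@cond _ X) p) ++ q).
      apply: (@ab_cat _ _ (~~ a)) aq' _.
        rewrite ab_ditrail_cons tr1 !eqxx /= last_map.
        by rewrite -[dsgn_in _]/(dsgn_in (last d p)) il -od eqxx andbT.
      apply/hasPn => e /iq; apply: contraL => /mapP[d2].
      rewrite -map_cons => /mapP[d3 _ ->] ->; exact: (valP d3.1).
    move: ap; rewrite cat_cons ab_ditrail_cons => /and5P[tr _ /eqP td /eqP od1 _].
    have [|p1 [p2 [_ h2]]] := hit_prefix (X := [set r]) tr; first by rewrite inE td.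
    by have := Nx _ _ h2 erefl; rewrite od1; case: (a).
  move=> d0 /src_apex sX o0 _; have tX := cond_notin sX.
  (* Either the neighbour has a hit of [r] leaving with [~~ a], and [arrive] applies, or it
     satisfies [N]. In the latter case the edge cannot have sign [a] there, as [ext] would put the
     neighbour into [X]; so the reversed edge alone is the required hit. *)
  have [[d [p [h s o]]]|nN] := pselect (exists d p,
      [/\ hit [set r] d p, dsrc d = dtgt (cond d0) & dsgn_out d = ~~ a]).
    have [p1 [h1 i1]] := arrive _ _ _ tX h s.
    have [|d' [p' [h' s' o' i']]] := push _ _ h1; first by rewrite s.
    by exists d', p'; rewrite s' s o' i' dtgt_cond.
  have [ia|ia] := eqVneq (dsgn_in (cond d0)) a.
    case/negP: tX; apply: (ext (flipd (cond d0))); rewrite ?dtgt_flipd //.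
      move=> d p h s; have [//|od] := eqVneq (dsgn_out d) a; case: nN; exists d, p.
      by split=> //; case: dsgn_out (a) od => [] [].
    by right; rewrite dsgn_in_flipd.
  have [||d' [p' [h' s' o' i']]] := push (flipd (cond d0)) [::].
  - by rewrite hit1 dtgt_flipd.
  - by [].
  exists d', p'; rewrite s' o' i' dtgt_cond; split=> //.
    by rewrite dsgn_out_flipd; case: dsgn_in (a) ia => [] [].
  by rewrite /= dsgn_in_flipd.
have lt : #|vert (contract X)| < #|vert K|.
  have [d [p [h s _]]] := L1 _ v0r.
  have : dsrc (last d p) \notin [set r] by apply: last_src h _; rewrite s inE.
  rewrite inE => zr; case/and3P: h => _ _; rewrite inE => /eqP tl.
  apply: (contract_lt (nbr (flipd (last d p)) tl) rX).
  by rewrite dtgt_flipd.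
apply: (@calL_glue a _ _ _ rH K val (IH _ _ lt RG) lin_H).
apply: gluing_contract => [|e b x ni ex]; first exact: rH.
rewrite !inE; apply: contraNneq ni => xr.
have sd : dsrc (e, b) = r by rewrite /dsrc /= ex xr.
by rewrite -[e]/(e, b).1 inside_dart nbr // sd rX.
Qed.

Lemma L_shape_imp_calL (K : bigraph) (r : vert K) : L_shape r -> calL a r.
Proof.
suff [] : (forall (K : bigraph) (r : vert K), L_shape r -> calL a r) /\
          (forall (K : bigraph) (r : vert K), R_shape r -> calR a r) by auto.
suff IH n : (forall (K : bigraph) (r : vert K), #|vert K| < n -> L_shape r -> calL a r) /\
          (forall (K : bigraph) (r : vert K), #|vert K| < n -> R_shape r -> calR a r).
  by split=> G s; have [h1 h2] := IH #|vert G|.+1; auto.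
elim: n => // n [IHL IHR]; split=> G s lt h.
  by apply: L_shape_calL h => H t ltH; apply: IHR; exact: leq_trans ltH _.
by apply: R_shape_calR h => H t ltH; apply: IHL; exact: leq_trans ltH _.
Qed.

End Shapes.

(** * The initial core at a strong root, and the equivalence *)

(** [X] is the vertex set of the closed ditrail: from each of its vertices, following it forwards or
    backwards yields both departure signs, and either way it reaches [r] with sign [~~ a]. At [r]
    itself the trivial ditrail serves for departure sign [a]. *)
Lemma closed_core (K : bigraph) a (r : vert K) :
  strong_vertex a r r ->
  exists2 X : {set vert K}, r \in X & core (fun _ _ => true) a r X.
Proof.
case=> -[|d p]; first by rewrite ab_ditrail_nil => /andP[_]; rewrite eqxx.
move=> adp; move: (adp).
rewrite ab_ditrail_cons => /and5P[/andP[sp up] /eqP sd /eqP td /eqP od /eqP il].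
pose X := [set w in [seq dtgt d | d <- d :: p]].
have rX : r \in X by rewrite inE -td map_f ?mem_last.
have iX e : e \in edges (d :: p) -> inside X e.
  case/mapP=> d1 h ->; rewrite inside_dart [dtgt d1 \in X]inE map_f // andbT.
  move: h; rewrite in_cons => /predU1P[->|/(path_src sp) h]; first by rewrite sd.
  by rewrite inE lastI map_rcons mem_rcons in_cons h orbT.
exists X => // v g vX _; move: vX; rewrite inE lastI map_rcons mem_rcons in_cons.
case/predU1P=> [->|vW].
  rewrite td; have [->|ga] := eqVneq g a.
    by exists [::]; rewrite // ab_ditrail_nil eqxx; case: (a).
  exists (d :: p); last exact: iX.
  by rewrite (_ : g = ~~ a) //; case: (g) (a) ga => [] [].
have [||q [iq hq]] := two_way g sp _ _ vW.
- by case/andP: up.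
- by move: up; rewrite lastI /edges map_rcons rcons_uniq => /andP[].
exists q => [|e /iq/iX //].
by move: hq; rewrite il td od sd; case.
Qed.

Theorem theorem11p4 (a : bool) (K : bigraph) (r : vert K) :
  (radial a r /\ strong_vertex a r r) <->
  exists (G : bigraph) (s : vert G) (H : bigraph) (rH : vert H)
         (i : vert H -> vert K),
    [/\ calL a s, strong_radial a rH, gluing_sum s [set: vert H] i & i rH = r].
Proof.
split=> [[rad /closed_core[X0 rX0 cX0]]|].
  have [|X [sX cX] mX] := core_ex _ cX0; first by [].
  have rX := subsetP sX _ rX0.
  pose rH : vert (induced X) := exist _ r rX.
  have reach (v : vert (induced X)) g : exists p, ab_ditrail g (~~ a) v rH p.
    have [p ap ip] := cX (val v) g (valP v) isT.
    exact: (@induced_ab _ _ _ _ v rH _ ap ip).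
  exists (contract X), (apex X), (induced X), rH, val; split=> //.
  - apply/L_shape_imp_calL/contract_L_shape => // v vX.
    have [[|d p]] := rad v.
      by rewrite ab_ditrail_nil => /andP[/eqP vr]; rewrite vr rX in vX.
    rewrite ab_ditrail_cons => /and5P[tr /eqP sd /eqP td /eqP od _].
    have [|p1 [_ [_ h1]]] := hit_prefix (X := X) tr; first by rewrite td.
    by exists d, p1.
  - by split=> v; apply: reach.
  by apply: gluing_contract => // e b x _ _; rewrite inE.
case=> G [s [H [rH [i [cG [radH strH] /gluing_ditrails[mapH cases] <-]]]]].
split; last by have [p /mapH[q aq _]] := strH rH; exists q.
move=> v; have [[w ->]|[u hu]] := cases v.
  by have [p /mapH[q aq _]] := radH w; exists q.
have [b [p ap /(hu _ _ _ ap)[t _ ht]]] := (cal_reach a).2 _ _ cG u.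
(* The arrival sign [b] at [s] is not under control, but a strong [H] offers both departure signs at
   every vertex [t]. *)
have [q /ht[q' aq _]] : exists q, ab_ditrail (~~ b) (~~ a) t rH q; last by exists q'.
have [->|ba] := eqVneq (~~ b) a; first exact: radH.
by rewrite (_ : ~~ b = ~~ a); [exact: strH|case: (b) (a) ba => [] []].
Qed.
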